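(* The relative commutant of the Poisson boundary $F(P_\omega)$ in the peripheral Poisson boundary $(P(P_\omega),\circ)$ is trivial, i.e. $$\{x\in P(P_\omega): x\circ a=a\circ x \text{ for all } a\in F(P_\omega)\}=\mathbb{C}1 .$$
   Context: $H$ is a separable Hilbert space with orthonormal basis $\{e_i: i\in\Theta\}$, where $\Theta=\{1,\dots,n\}$ with $n>1$, or $\Theta=\mathbb{N}$. $\mathcal{F}(H)=\bigoplus_{n\ge 0}H^{\otimes n}$ is the full Fock space, with $H^{\otimes 0}=\mathbb{C}\Omega$, $\Omega$ a unit (vacuum) vector. For $\xi\in H$, $l_\xi$ is the left creation operator on $\mathcal{F}(H)$, $l_\xi(\eta)=\xi\otimes\eta$ (with $l_\xi\Omega=\xi$), and $l_i=l_{e_i}$. $\omega=(\omega_i)_{i\in\Theta}$ is a family of positive reals with $\sum_{i\in\Theta}\omega_i=1$, and $P_\omega:B(\mathcal{F}(H))\to B(\mathcal{F}(H))$ is the normal unital completely positive map $P_\omega(x)=\sum_{i\in\Theta}\omega_i\, l_i^*xl_i$. For $\lambda\in\mathbb{T}$ (unit circle), $E_\lambda(P_\omega)=\{x: P_\omega(x)=\lambda x\}$. The Poisson boundary is $F(P_\omega)=E_1(P_\omega)$. The peripheral Poisson boundary $P(P_\omega)$ is the norm-closed linear span in $B(\mathcal F(H))$ of $\bigcup_{\lambda\in\mathbb{T}}E_\lambda(P_\omega)$. It is known (Bhat–Kar–Talwar) that $P(P_\omega)$ is a unital C*-algebra with the operator norm, the usual adjoint, unit $1$, and the modified Choi–Effros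 product $\circ$, the unique norm-continuous bilinear map on $P(P_\omega)$ such that $x\circ y=\text{SOT-}\lim_{m\to\infty}(\lambda\mu)^{-m}P_\omega^m(xy)$ for $x\in E_\lambda(P_\omega)$, $y\in E_\mu(P_\omega)$. Restricted to $F(P_\omega)$, $\circ$ is the Choi–Effros product, and $F(P_\omega)$ is a C*-subalgebra of $(P(P_\omega),\circ)$. *)

(* Defs.v *)
From mathcomp Require Import all_boot all_order all_algebra.
From mathcomp Require Import sesquilinear complex.
From mathcomp Require Import all_classical all_reals all_analysis.

Set Implicit Arguments.
Unset Strict Implicit.
Unset Printing Implicit Defensive.

Import Order.TTheory GRing.Theory Num.Theory numFieldNormedType.Exports.
Local Open Scope classical_set_scope.
Local Open Scope ring_scope.
Local Open Scope complex_scope.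

(* The inner product is linear in the first variable and conjugate-linear in
   the second one. *)
Record hilbert (R : realType) := Hilbert {
  hilbert_carrier :> completeNormedModType R[i] ;
  dotp : {dot hilbert_carrier for Num.conj} ;
  dotp_norm : forall u, `|u| ^+ 2 = dotp u u }.

Arguments dotp {R h}.

Definition lin_span (K : nzRingType) (V : lmodType K) (A : set V) : set V :=
  [set v | exists (n : nat) (c : 'I_n -> K) (a : 'I_n -> V),
     (forall k, A (a k)) /\ v = \sum_(k < n) c k *: a k].

Definition orthonormal_basis (R : realType) (H : hilbert R) (Theta : set nat)
    (e : nat -> H) : Prop :=
  (forall i j, Theta i -> Theta j -> dotp (e i) (e j) = (i == j)%:R) /\
  closure (lin_span (e @` Theta)) = setT.

(* [tens [:: xi_1; ...; xi_n]] is the simple tensor xi_1 (x) ... (x) xi_n, and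
   [tens [::]] is the vacuum vector.  The inner product formula is that of the
   Hilbert space direct sum of the tensor powers of [H]: it makes [tens]
   multilinear in tensors of a given length and tensors of different lengths
   orthogonal.  Together with density it determines [fock_space] up to a unique
   unitary preserving [tens]. *)
Record full_fock (R : realType) (H : hilbert R) := FullFock {
  fock_space :> hilbert R ;
  tens : seq H -> fock_space ;
  dotp_tens : forall s t : seq H,
    dotp (tens s) (tens t) =
      if size s == size t then \prod_(p <- zip s t) dotp p.1 p.2 else 0 ;
  tens_total : closure (lin_span (range tens)) = setT }.

Section Operators.
Variables (R : realType) (K : hilbert R).

Definition bounded_op : set (K -> K) :=
  [set T | linear T /\ exists c : R, forall v, `|T v| <= c%:C * `|v|].

Definition op_norm (T : K -> K) : R :=
  inf [set c : R | 0 <= c /\ forall v, `|T v| <= c%:C * `|v|].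

Definition is_adjoint (T S : K -> K) : Prop :=
  forall u v, dotp (T u) v = dotp u (S v).

Definition norm_closure (A : set (K -> K)) : set (K -> K) :=
  [set x | bounded_op x /\
     forall eps : R, 0 < eps -> exists2 y, A y & op_norm (x - y) < eps].

End Operators.

Definition left_creation (R : realType) (H : hilbert R) (F : full_fock H)
    (xi : H) (T : F -> F) : Prop :=
  bounded_op T /\ forall s : seq H, T (tens F s) = tens F (xi :: s).

Section Peripheral.
Variables (R : realType) (K : hilbert R).

(* The sum over [Theta] is taken in the strong operator topology. *)
Definition weighted_transfer (Theta : set nat) (omega : nat -> R)
    (l l_adj : nat -> K -> K) (x : K -> K) : K -> K :=
  fun v => lim ((fun n : nat => \sum_(0 <= i < n | i \in Theta)
                  (omega i)%:C *: l_adj i (x (l i v))) @ \oo).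

Variable P : (K -> K) -> (K -> K).

Definition eigenspace (lambda : R[i]) : set (K -> K) :=
  [set x | bounded_op x /\ P x = lambda *: x].

Definition poisson_boundary : set (K -> K) := eigenspace 1.

Definition peripheral_boundary : set (K -> K) :=
  norm_closure
    (lin_span (\bigcup_(lambda in [set z : R[i] | `|z| = 1]) eigenspace lambda)).

(* [circ] is only relevant on [peripheral_boundary]; there, these conditions
   determine it. *)
Record modified_choi_effros (circ : (K -> K) -> (K -> K) -> (K -> K)) : Prop := {
  circ_closed : forall x y, peripheral_boundary x -> peripheral_boundary y ->
    peripheral_boundary (circ x y) ;
  circ_linearl : forall (c : R[i]) x x' y, peripheral_boundary x ->
    peripheral_boundary x' -> peripheral_boundary y ->
    circ (c *: x + x') y = c *: circ x y + circ x' y ;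
  circ_linearr : forall (c : R[i]) x y y', peripheral_boundary x ->
    peripheral_boundary y -> peripheral_boundary y' ->
    circ x (c *: y + y') = c *: circ x y + circ x y' ;
  circ_continuous : forall x y, peripheral_boundary x ->
    peripheral_boundary y -> forall eps : R, 0 < eps ->
    exists2 delta : R, 0 < delta & forall x' y', peripheral_boundary x' ->
      peripheral_boundary y' -> op_norm (x' - x) < delta ->
      op_norm (y' - y) < delta -> op_norm (circ x' y' - circ x y) < eps ;
  circ_eigenspace : forall (lambda mu : R[i]) x y,
    `|lambda| = 1 -> `|mu| = 1 -> eigenspace lambda x -> eigenspace mu y ->
    forall v, (fun m : nat => (lambda * mu) ^- m *: iter m P (x \o y) v) @ \oo
                --> circ x y v }.

End Peripheral.

(* Main.v *)
(* The right creation operators r_j commute with every l_i, hence are fixed by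
   P.  For x in the peripheral boundary this gives x o r_j = x r_j and
   r_k^* (r_j o x) = delta_jk x, so an x commuting with all the r_j satisfies
   r_k^* x r_j = delta_jk x: all its matrix coefficients in the basis of words
   are determined by <x Omega, e_V> and <x e_V, Omega>.  On such an x, P acts on
   these coefficients by rotating V and multiplying by a weight omega_k < 1, so
   for V nonempty the coefficients of P^m x tend to 0 as m grows.  But
   m |-> P^m x is almost periodic, so they vanish already for m = 0, and x is a
   scalar. *)

Require Import Defs.
From mathcomp Require Import all_boot all_order all_algebra.
From mathcomp Require Import sesquilinear complex.
From mathcomp Require Import all_classical all_reals all_analysis.
From mathcomp Require Import ring lra.

Import Order.TTheory GRing.Theory Num.Theory numFieldNormedType.Exports.
Local Open Scope classical_set_scope.
Local Open Scope ring_scope.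
Local Open Scope complex_scope.

Set Implicit Arguments.
Unset Strict Implicit.
Unset Printing Implicit Defensive.

(** * Hilbert spaces and bounded operators *)

(** The two products with [r_j] are handled differently because [r_j] commutes with every [l_i] but
    not with their adjoints. As a right factor it passes through [P]. As a left factor it does not,
    and only coefficients against vectors in the range of some [r_k] can be computed; these ranges
    and the vacuum together span the Fock space. The argument therefore runs on coefficients
    [dotp (x u) w], where adjoints disappear. The product is given by a formula on eigenvectors
    only, and a peripheral element is merely a norm limit of their combinations, so each identity is
    checked on eigenvectors and extended by linearity and norm continuity. For the recurrence, one
    approximant serves all powers [P^m], since these do not increase the norm. Having two letters
    matters for the decay: a single letter would have weight 1, while with two of them every weight
    is at most [1 - omega 0] or [1 - omega 1], a bound below 1 that also covers infinite [Theta]. *)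

Lemma gt0_complex (R : realType) (eps : R[i]) :
  0 < eps -> exists2 r : R, 0 < r & eps = r%:C.
Proof.
move=> e0; have /complex_realP[r er] := gtr0_real e0.
by exists r => //; rewrite -ltcR -er.
Qed.

Section HilbertBasics.
Context {R : realType} {K : hilbert R}.
Implicit Types u v w : K.

Lemma dotpDl u v w : dotp (u + v) w = dotp u w + dotp v w.
Proof. exact: linearDl. Qed.

Lemma dotpZl a u w : dotp (a *: u) w = a * dotp u w.
Proof. exact: linearZl_LR. Qed.

Lemma dotpBl u v w : dotp (u - v) w = dotp u w - dotp v w.
Proof. exact: linearBl. Qed.

Lemma dotp0l w : dotp 0 w = 0 :> R[i].
Proof. exact: linear0l. Qed.

Lemma dotpDr u v w : dotp u (v + w) = dotp u v + dotp u w.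
Proof. exact: linearDr. Qed.

Lemma dotpBr u v w : dotp u (v - w) = dotp u v - dotp u w.
Proof. exact: linearBr. Qed.

Lemma dotp0r w : dotp w 0 = 0 :> R[i].
Proof. exact: linear0r. Qed.

Lemma dotpZr a u w : dotp u (a *: w) = Num.conj a * dotp u w.
Proof. exact: linearZr_LR. Qed.

Lemma dotpC u v : dotp u v = Num.conj (dotp v u).
Proof. by rewrite hermC expr0 mul1r. Qed.

Lemma dotp_suml I (r : seq I) (P : pred I) (E : I -> K) w :
  dotp (\sum_(i <- r | P i) E i) w = \sum_(i <- r | P i) dotp (E i) w.
Proof. exact: linear_sumlz. Qed.

Lemma dotp_sumr I (r : seq I) (P : pred I) (E : I -> K) w :
  dotp w (\sum_(i <- r | P i) E i) = \sum_(i <- r | P i) dotp w (E i).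
Proof. exact: linear_sumr. Qed.

Lemma dotp_eq0 u : dotp u u = 0 -> u = 0.
Proof. by rewrite -dotp_norm => /eqP; rewrite sqrf_eq0 normr_eq0 => /eqP. Qed.

Lemma dotp_le u v : `|dotp u v| <= `|u| * `|v|.
Proof.
have [->|v0] := eqVneq v 0; first by rewrite dotp0r !normr0 mulr0.
have v20 : 0 < `|v| ^+ 2 by rewrite exprn_gt0 // normr_gt0.
(* Cauchy-Schwarz without division: this quantity is the squared norm of [|v|^2 u - <u, v> v]. *)
suff : 0 <= `|v| ^+ 2 * (`|v| ^+ 2 * `|u| ^+ 2 - `|dotp u v| ^+ 2).
  rewrite pmulr_rge0 // subr_ge0 mulrC -exprMn => h.
  by rewrite -(@ler_pXn2r _ 2) // nnegrE ?mulr_ge0 ?normr_ge0.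
have := exprn_ge0 2 (normr_ge0 (`|v| ^+ 2 *: u - dotp u v *: v)).
rewrite [X in 0 <= X]dotp_norm dotpBl !dotpBr !dotpZl !dotpZr -!dotp_norm (dotpC v u) normCK.
have -> : Num.conj (`|v| ^+ 2) = `|v| ^+ 2.
  by apply: conj_Creal; rewrite ger0_real // exprn_ge0.
by congr (0 <= _); ring.
Qed.

Lemma lipschitz_bound_continuous (V : normedModType R[i]) (f : K -> V) (c : R) :
  (forall u v, `|f u - f v| <= c%:C * `|u - v|) -> continuous f.
Proof.
move=> fc u; have c1 : 0 < (`|c| + 1)%:C :> R[i] by rewrite ltcR ltr_wpDl.
apply/cvgrPdist_lt => eps e0; near=> v.
apply: le_lt_trans (fc u v) _.
apply: (@le_lt_trans _ _ ((`|c| + 1)%:C * `|u - v|)).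
  by apply: ler_wpM2r => //; rewrite lecR (le_trans (ler_norm c)) // lerDl.
rewrite mulrC -ltr_pdivlMr //.
near: v; have /cvgrPdist_lt h : v @[v --> u] --> u by exact: cvg_id.
by apply: h; rewrite divr_gt0.
Unshelve. all: by end_near. Qed.

Lemma dotpl_continuous w : continuous (fun u : K => dotp u w : R[i]^o).
Proof.
have [c cE] : exists c : R, `|w| = c%:C.
  have /complex_realP [c ->] : `|w| \is Num.real by exact: normr_real.
  by exists c.
apply: (@lipschitz_bound_continuous _ _ c) => u v.
by rewrite -dotpBl mulrC -cE; exact: dotp_le.
Qed.

Lemma dotpr_continuous w : continuous (fun u : K => dotp w u : R[i]^o).
Proof.
have [c cE] : exists c : R, `|w| = c%:C.
  have /complex_realP [c ->] : `|w| \is Num.real by exact: normr_real.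
  by exists c.
apply: (@lipschitz_bound_continuous _ _ c) => u v.
by rewrite -dotpBr -cE; exact: dotp_le.
Qed.

Lemma closed_eq_fun (V : normedModType R[i]) (f g : K -> V) :
  continuous f -> continuous g -> closed [set v | f v = g v].
Proof.
move=> cf cg.
rewrite (_ : [set _ | _] = (fun v => f v - g v) @^-1` [set 0]).
  have /continuous_closedP : continuous (fun v => f v - g v).
    by move=> v; apply: cvgB; [exact: cf|exact: cg].
  apply.
  exact: (accessible_closed_set1 (hausdorff_accessible (@norm_hausdorff _ V))).
by apply/seteqP; split=> v /= => [->|/eqP]; rewrite ?subrr // subr_eq0 => /eqP.
Qed.

Lemma closed_subspace_total (A D : set K) :
  closure (lin_span A) = setT -> closed D -> D 0 ->
  (forall c u v, D u -> D v -> D (c *: u + v)) -> A `<=` D ->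
  forall v, D v.
Proof.
move=> Atot Dcl D0 Dlin AD v.
have : closure (lin_span A) v by rewrite Atot.
suff : closure (lin_span A) `<=` D by apply.
rewrite (closure_id D).1 //; apply: closure_subset => w [n [c [a [aA ->]]]].
elim/big_ind: _ => // [x y Dx Dy|i _]; first by rewrite -[x]scale1r; exact: Dlin.
by rewrite -[_ *: _]addr0; apply: Dlin => //; exact: AD.
Qed.

(** A Cauchy criterion for two uses: [k = 0] for series dominated in norm, [k = 1] for orthogonal
    series, whose squared norms add up. *)
Lemma cvg_dominated (u : nat -> K) (s : nat -> R) k :
  (forall m n, (m <= n)%N -> `|u n - u m| ^+ k.+1 <= (s n - s m)%:C) ->
  cvgn s -> cvgn u.
Proof.
move=> us /cvg_ex[l sl]; apply/cauchy_cvgP; apply: cauchy_exP => eps.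
move=> /gt0_complex[r r0 ->].
have r'0 : 0 < r ^+ k.+1 / 2 by rewrite divr_gt0 // exprn_gt0.
have /cvgrPdist_lt /(_ _ r'0) [N _ hN] := sl.
exists (u N); exists N => // n /= Nn.
rewrite -ball_normE /= distrC.
rewrite -(@ltr_pXn2r _ k.+1) // ?nnegrE ?ler0c ?normr_ge0 ?(ltW r0) //.
apply: le_lt_trans (us _ _ Nn) _.
rewrite -rmorphXn ltcR.
have := hN _ (leqnn N); have := hN _ Nn; rewrite /= !ltr_norml.
by move=> /andP[? ?] /andP[? ?]; lra.
Qed.

End HilbertBasics.

Lemma norm_real (R : realType) (K : hilbert R) (v : K) :
  exists2 r : R, 0 <= r & `|v| = r%:C.
Proof.
have /complex_realP [r vr] : `|v| \is Num.real by exact: normr_real.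
by exists r => //; rewrite -ler0c -vr.
Qed.

Section BoundedOp.
Context {R : realType} {K : hilbert R}.
Implicit Types (T S : K -> K) (u v w : K).

Section Linear.
Variable T : K -> K.
Hypothesis bT : bounded_op T.

Lemma bounded_opP c u v : T (c *: u + v) = c *: T u + T v.
Proof. by case: bT => lT _; rewrite lT. Qed.

Lemma bounded_op0 : T 0 = 0.
Proof. by have := bounded_opP (-1) 0 0; rewrite scaler0 addr0 scaleN1r addNr. Qed.

Lemma bounded_opZ c u : T (c *: u) = c *: T u.
Proof. by have := bounded_opP c u 0; rewrite bounded_op0 !addr0. Qed.

Lemma bounded_opB u v : T (u - v) = T u - T v.
Proof. by rewrite addrC -scaleN1r bounded_opP scaleN1r addrC. Qed.

Lemma bounded_op_ge0 : exists2 c : R, 0 <= c & forall v, `|T v| <= c%:C * `|v|.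
Proof.
case: bT => _ [c Tc]; exists `|c| => // v; apply: le_trans (Tc v) _.
by rewrite ler_wpM2r // lecR ler_norm.
Qed.

Lemma bounded_op_continuous : continuous T.
Proof.
have [c _ Tc] := bounded_op_ge0.
by apply: (@lipschitz_bound_continuous _ _ _ _ c) => u v; rewrite -bounded_opB.
Qed.

Lemma op_norm_bound v : `|T v| <= (op_norm T)%:C * `|v|.
Proof.
have [->|v0] := eqVneq v 0; first by rewrite bounded_op0 !normr0 mulr0.
have [n _ vn] := norm_real v; have [m _ Tvm] := norm_real (T v).
have n0 : 0 < n by rewrite -ltcR -vn normr_gt0.
rewrite vn Tvm -rmorphM lecR -ler_pdivrMr //.
apply: lb_le_inf; first by have [c c0 Tc] := bounded_op_ge0; exists c.
move=> c [_ /(_ v)]; rewrite vn Tvm -rmorphM lecR.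
by rewrite -ler_pdivrMr.
Qed.

Lemma op_norm_ge0 : 0 <= op_norm T.
Proof.
apply: lb_le_inf; first by have [c c0 Tc] := bounded_op_ge0; exists c.
by move=> c [].
Qed.

End Linear.

Lemma op_norm_le T (c : R) :
  0 <= c -> (forall v, `|T v| <= c%:C * `|v|) -> op_norm T <= c.
Proof. by move=> c0 Tc; apply: ge_inf => //; exists 0 => y []. Qed.

Lemma bounded_op_id : bounded_op (idfun : K -> K).
Proof. by split=> // ; exists 1 => v; rewrite mul1r. Qed.

Lemma bounded_op_comp T S : bounded_op T -> bounded_op S -> bounded_op (T \o S).
Proof.
move=> bT bS; split=> [c u v|]; first by rewrite /= !bounded_opP.
have [c c0 Tc] := bounded_op_ge0 bT; have [d d0 Sd] := bounded_op_ge0 bS.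
exists (c * d) => v /=; apply: le_trans (Tc _) _.
by rewrite rmorphM -mulrA ler_wpM2l // ler0c.
Qed.

Lemma bounded_op_lin a T S :
  bounded_op T -> bounded_op S -> bounded_op (a *: T + S).
Proof.
have linE v : (a *: T + S) v = a *: T v + S v by [].
move=> bT bS; split=> [c u v|].
  rewrite !linE (bounded_opP bT) (bounded_opP bS) !scalerDr !scalerA (mulrC a c).
  by rewrite addrACA.
have [c c0 Tc] := bounded_op_ge0 bT; have [d d0 Sd] := bounded_op_ge0 bS.
have /complex_realP [r ar] : `|a| \is Num.real by exact: normr_real.
exists (r * c + d) => v.
have -> : (r * c + d)%:C = `|a| * c%:C + d%:C by rewrite ar -rmorphM -rmorphD.
rewrite linE mulrDl.
apply: le_trans (ler_normD _ _) _; apply: lerD => //.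
by rewrite normrZ -mulrA ler_wpM2l.
Qed.

Lemma norm_lim_le (u : nat -> K) l (c : R) :
  u n @[n --> \oo] --> l -> (forall n, `|u n| <= c%:C) -> `|l| <= c%:C.
Proof.
move=> /cvgrPdist_lt ul uc; have [p p0 lp] := norm_real l.
rewrite lp lecR; apply/ler_addgt0Pr => e e0.
have /ul[N _ /(_ N (leqnn N)) /= h] : 0 < e%:C :> R[i] by rewrite ltcR.
rewrite -lecR -lp rmorphD -[l](subrK (u N)) (le_trans (ler_normD _ _)) // addrC.
exact: lerD (ltW h).
Qed.

End BoundedOp.

(** * The transfer operator *)

Lemma sum_nat_tail (R : realType) (K : hilbert R) (Q : pred nat) (f : nat -> K) m n :
  (m <= n)%N ->
  \sum_(0 <= i < n | Q i) f i - \sum_(0 <= i < m | Q i) f i =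
  \sum_(m <= i < n | Q i) f i.
Proof.
move=> mn; apply/eqP; rewrite subr_eq; apply/eqP.
by rewrite (big_cat_nat (leq0n m) mn) addrC.
Qed.

Section WeightedTransfer.
Context {R : realType} {K : hilbert R}.
Variables (Theta : set nat) (omega : nat -> R) (l l_adj : nat -> K -> K).
Hypothesis omega_ge0 : forall i, Theta i -> 0 <= omega i.
Hypothesis omega_sum :
  (fun n => \sum_(0 <= i < n | i \in Theta) omega i) @ \oo --> (1 : R).
Hypothesis l_bounded : forall i, Theta i -> bounded_op (l i).
Hypothesis l_isometry : forall i u v, Theta i -> dotp (l i u) (l i v) = dotp u v.
Hypothesis l_adjoint : forall i, Theta i -> is_adjoint (l i) (l_adj i).

Local Notation P := (weighted_transfer Theta omega l l_adj).
Implicit Types (x y z : K -> K) (u v w : K).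

Lemma l_norm i v : Theta i -> `|l i v| = `|v|.
Proof.
move=> Ti; apply/eqP; rewrite -(@eqrXn2 _ 2) //.
by rewrite dotp_norm [X in _ == X]dotp_norm l_isometry.
Qed.

Lemma dotp_l_adj i u v : Theta i -> dotp (l_adj i u) v = dotp u (l i v).
Proof. by move=> Ti; rewrite dotpC -(l_adjoint Ti) -dotpC. Qed.

Lemma l_adj_norm i v : Theta i -> `|l_adj i v| <= `|v|.
Proof.
move=> Ti; have [->|n0] := eqVneq (l_adj i v) 0; first by rewrite normr0.
suff : `|l_adj i v| ^+ 2 <= `|v| * `|l_adj i v|.
  by rewrite expr2 ler_pM2r // normr_gt0.
rewrite -[X in X <= _]ger0_norm ?exprn_ge0 //.
rewrite dotp_norm (dotp_l_adj _ _ Ti) (le_trans (dotp_le _ _)) //.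
by rewrite (l_norm _ Ti).
Qed.

(** Linearity comes from the adjoint relation alone: the defect of linearity is orthogonal to every
    vector, hence to itself. *)
Lemma l_adj_bounded i : Theta i -> bounded_op (l_adj i).
Proof.
move=> Ti; split=> [c u v|].
  apply/eqP; rewrite -subr_eq0; apply/eqP/dotp_eq0.
  rewrite dotpBl dotpDl dotpZl !(dotp_l_adj _ _ Ti) -dotpZl -dotpDl.
  by rewrite subrr.
by exists 1 => v; rewrite mul1r; exact: l_adj_norm.
Qed.

Lemma omega_sum_le1 n : \sum_(0 <= i < n | i \in Theta) omega i <= 1.
Proof.
have h := cvg_lim (@Rhausdorff R) omega_sum; rewrite -h.
apply: nondecreasing_cvgn_le; last by apply/cvg_ex; exists 1.
move=> p q pq; rewrite [leRHS](big_cat_nat (leq0n p) pq) lerDl.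
by apply: sumr_ge0 => i; rewrite inE => /omega_ge0.
Qed.

Let partial x v n := \sum_(0 <= i < n | i \in Theta)
  (omega i)%:C *: l_adj i (x (l i v)).

(** Stated on a window from [m] to [n] to serve twice: arbitrary windows make the partial sums
    Cauchy, and [m = 0] shows that [P] does not increase the norm. *)
Lemma transfer_tail x (c : R) v m n :
  (forall u, `|x u| <= c%:C * `|u|) ->
  `|\sum_(m <= i < n | i \in Theta) (omega i)%:C *: l_adj i (x (l i v))|
    <= (\sum_(m <= i < n | i \in Theta) omega i)%:C * (c%:C * `|v|).
Proof.
move=> xc; apply: le_trans (ler_norm_sum _ _ _) _.
rewrite rmorph_sum /= mulr_suml; apply: ler_sum => i; rewrite inE => Ti.
rewrite normrZ ger0_norm ?ler0c ?omega_ge0 //.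
rewrite ler_wpM2l ?ler0c ?omega_ge0 //.
by rewrite (le_trans (l_adj_norm _ Ti)) // (le_trans (xc _)) // (l_norm _ Ti).
Qed.

Lemma transfer_cvg x v : bounded_op x -> partial x v n @[n --> \oo] --> P x v.
Proof.
move=> bx; have [c c0 xc] := bounded_op_ge0 bx; have [r r0 vr] := norm_real v.
suff : cvgn (partial x v) by [].
apply: (@cvg_dominated _ _ _
  (fun n => (\sum_(0 <= i < n | i \in Theta) omega i) * (c * r)) 0).
  move=> m n mn; rewrite expr1 sum_nat_tail // (le_trans (transfer_tail _ _ _ xc)) //.
  rewrite vr -!rmorphM lecR -mulrBl.
  by rewrite (big_cat_nat (leq0n m) mn) [X in X - _]addrC addrK.
by apply/cvg_ex; exists (1 * (c * r)); apply: cvgMl.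
Qed.

Lemma transfer_bound x (c : R) v : bounded_op x -> 0 <= c ->
  (forall u, `|x u| <= c%:C * `|u|) -> `|P x v| <= c%:C * `|v|.
Proof.
move=> bx c0 xc; have [r r0 vr] := norm_real v; rewrite vr -rmorphM.
apply: norm_lim_le (@transfer_cvg x v bx) _ => n.
rewrite (le_trans (transfer_tail _ _ _ xc)) // vr -!rmorphM lecR.
by rewrite ler_piMl ?mulr_ge0 //; exact: omega_sum_le1.
Qed.

Lemma transfer_lin a x y : bounded_op x -> bounded_op y ->
  P (a *: x + y) = a *: P x + P y.
Proof.
move=> bx by_; apply/funext => v.
have h : partial (a *: x + y) v n @[n --> \oo] --> a *: P x v + P y v.
  have -> : partial (a *: x + y) v = fun n => a *: partial x v n + partial y v n.
    apply/funext => n; rewrite /partial scaler_sumr -big_split /=.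
    apply: eq_bigr => i; rewrite inE => Ti.
    rewrite (_ : (a *: x + y) (l i v) = a *: x (l i v) + y (l i v)) //.
    by rewrite (bounded_opP (l_adj_bounded Ti)) scalerDr !scalerA mulrC.
  by apply: cvgD; [apply: cvgZl_tmp|]; exact: transfer_cvg.
exact: cvg_lim h.
Qed.

Lemma transfer_bounded x : bounded_op x -> bounded_op (P x).
Proof.
move=> bx; split=> [c u v|]; last first.
  have [c c0 xc] := bounded_op_ge0 bx; exists c => v; exact: transfer_bound.
have h : partial x (c *: u + v) n @[n --> \oo] --> c *: P x u + P x v.
  have -> : partial x (c *: u + v) = fun n => c *: partial x u n + partial x v n.
    apply/funext => n; rewrite /partial scaler_sumr -big_split /=.
    apply: eq_bigr => i; rewrite inE => Ti.
    rewrite (bounded_opP (l_bounded Ti)) (bounded_opP bx).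
    by rewrite (bounded_opP (l_adj_bounded Ti)) scalerDr !scalerA mulrC.
  by apply: cvgD; [apply: cvgZl_tmp|]; exact: transfer_cvg.
exact: cvg_lim h.
Qed.

(** The weak form of [P]: [l_adj] has moved to the other side as [l], so coefficients can be
    computed from the action of the [l i] on words. *)
Lemma dotp_transfer x v w : bounded_op x ->
  (\sum_(0 <= i < n | i \in Theta) (omega i)%:C * dotp (x (l i v)) (l i w) : R[i]^o)
    @[n --> \oo] --> (dotp (P x v) w : R[i]^o).
Proof.
move=> bx; have h := @transfer_cvg x v bx.
have := cvg_comp _ _ h (@dotpl_continuous _ _ w (P x v)).
rewrite (_ : _ \o _ = fun n => \sum_(0 <= i < n | i \in Theta)
   (omega i)%:C * dotp (x (l i v)) (l i w)) //.
apply/funext => n /=; rewrite dotp_suml; apply: eq_bigr => i; rewrite inE => Ti.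
by rewrite dotpZl (dotp_l_adj _ _ Ti).
Qed.

Lemma dotp_transfer_eq x z a u w u' w' : bounded_op x -> bounded_op z ->
  (forall i, Theta i ->
     dotp (x (l i u)) (l i w) = a * dotp (z (l i u')) (l i w')) ->
  dotp (P x u) w = a * dotp (P z u') w'.
Proof.
move=> bx bz xz; have hx := @dotp_transfer x u w bx; have hz := @dotp_transfer z u' w' bz.
apply: (@cvg_unique _ (@norm_hausdorff _ R[i]^o) _ _ _ _ hx).
rewrite (_ : (fun n => _) = fun n => a *: (\sum_(0 <= i < n | i \in Theta)
   (omega i)%:C * dotp (z (l i u')) (l i w') : R[i]^o)).
  by apply: cvgZl_tmp.
apply/funext => n; rewrite scaler_sumr; apply: eq_bigr => i; rewrite inE => Ti.
by rewrite xz // mulrCA.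
Qed.

Lemma dotp_transfer_single x k u w : bounded_op x -> Theta k ->
  (forall i, Theta i -> i != k -> dotp (x (l i u)) (l i w) = 0) ->
  dotp (P x u) w = (omega k)%:C * dotp (x (l k u)) (l k w).
Proof.
move=> bx Tk xk; have hx := @dotp_transfer x u w bx.
apply: (@cvg_unique _ (@norm_hausdorff _ R[i]^o) _ _ _ _ hx).
apply: cvg_near_cst; exists k.+1 => // n /= kn.
rewrite big_mkcond (bigD1_seq k) ?mem_index_iota ?iota_uniq //= mem_set //.
rewrite big1 ?addr0 // => i ik; case: ifPn => //; rewrite inE => Ti.
by rewrite xk // mulr0.
Qed.

(** Each [l_i^* x l_i] equals [l_i^* l_i x = x], so the partial sums are [x v] times the partial
    sums of the weights. *)
Lemma transfer_commuting x : bounded_op x ->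
  (forall i v, Theta i -> x (l i v) = l i (x v)) -> P x = x.
Proof.
move=> bx xl; apply/funext => v.
have h : partial x v n @[n --> \oo] --> x v.
  have -> : partial x v =
      fun n => (\sum_(0 <= i < n | i \in Theta) omega i)%:C *: x v.
    apply/funext => n; rewrite /partial rmorph_sum scaler_suml.
    apply: eq_bigr => i; rewrite inE => Ti; rewrite xl //; congr (_ *: _).
    apply/eqP; rewrite -subr_eq0; apply/eqP/dotp_eq0.
    by rewrite dotpBl (dotp_l_adj _ _ Ti) l_isometry // subrr.
  rewrite -[X in _ --> X]scale1r; apply: cvgZr_tmp.
  apply/cvgrPdist_lt => _ /gt0_complex[e e0 ->].
  have /cvgrPdist_lt/(_ _ e0) := omega_sum.
  apply: filterS => n h; rewrite -(rmorph1 (real_complex R)) -rmorphB.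
  by rewrite normc_def /= expr0n addr0 sqrtr_sqr ltcR.
exact: cvg_lim h.
Qed.

Lemma transfer_comp x r :
  (forall i v, Theta i -> r (l i v) = l i (r v)) -> P (x \o r) = P x \o r.
Proof.
move=> rl; apply/funext => v.
have E : partial (x \o r) v = partial x (r v).
  by apply/funext => n; apply: eq_bigr => i; rewrite inE => Ti; rewrite /= rl.
by rewrite /comp /weighted_transfer -/(partial (x \o r) v) E.
Qed.

Lemma iter_transfer_bounded m x : bounded_op x -> bounded_op (iter m P x).
Proof. by elim: m => //= m IH bx; apply/transfer_bounded/IH. Qed.

Lemma iter_transfer_bound m x (c : R) v : bounded_op x -> 0 <= c ->
  (forall u, `|x u| <= c%:C * `|u|) -> `|iter m P x v| <= c%:C * `|v|.
Proof.
move=> bx c0 xc; elim: m v => //= m IH v; apply: transfer_bound => //.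
exact: iter_transfer_bounded.
Qed.

Lemma iter_transfer_lin m a x y : bounded_op x -> bounded_op y ->
  iter m P (a *: x + y) = a *: iter m P x + iter m P y.
Proof.
move=> bx by_; elim: m => //= m ->.
by apply: transfer_lin; exact: iter_transfer_bounded.
Qed.

Lemma iter_transfer_comp m x r :
  (forall i v, Theta i -> r (l i v) = l i (r v)) ->
  iter m P (x \o r) = iter m P x \o r.
Proof. by move=> rl; elim: m => //= m ->; rewrite transfer_comp. Qed.

Lemma transfer0 : P 0 = 0.
Proof.
have b0 : bounded_op (0 : K -> K).
  by split=> [c u v|]; [rewrite scaler0 addr0|exists 0 => v; rewrite mul0r normr0].
by have := transfer_lin (-1) b0 b0; rewrite scaler0 addr0 scaleN1r addNr.
Qed.

Lemma transferZ a x : bounded_op x -> P (a *: x) = a *: P x.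
Proof.
move=> bx; have b0 : bounded_op (0 : K -> K).
  by split=> [c u v|]; [rewrite scaler0 addr0|exists 0 => v; rewrite mul0r normr0].
by have := transfer_lin a bx b0; rewrite transfer0 !addr0.
Qed.

Lemma iter_transfer_eigen m lambda x : Defs.eigenspace P lambda x ->
  iter m P x = lambda ^+ m *: x.
Proof.
move=> [bx Px]; elim: m => [|m IH] /=; first by rewrite expr0 scale1r.
by rewrite IH transferZ // Px scalerA exprSr.
Qed.

(** Weak form of [r'^* P^m(x) r = a P^m(z)] when [r'^* x r = a z]. Both [r] and [r'] can be moved
    across the [l i], each in its own argument of [dotp], so no commutation with [l_adj] is
    required. *)
Lemma iter_transfer_dotp m x z a (r r' : K -> K) : bounded_op x -> bounded_op z ->
  (forall i v, Theta i -> r (l i v) = l i (r v)) ->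
  (forall i v, Theta i -> r' (l i v) = l i (r' v)) ->
  (forall u w, dotp (x (r u)) (r' w) = a * dotp (z u) w) ->
  forall u w, dotp (iter m P x (r u)) (r' w) = a * dotp (iter m P z u) w.
Proof.
move=> bx bz rl rl' xz; elim: m => //= m IH u w.
apply: dotp_transfer_eq; [exact: iter_transfer_bounded..|move=> i Ti].
by rewrite -rl // -rl' // IH.
Qed.

End WeightedTransfer.

(** * The Fock space and right creation operators *)

Section PartialIsometry.
Context {R : realType} {K : hilbert R}.
Variables (D : pred nat) (b c : nat -> K).
Hypothesis b_orth : forall i j, dotp (b i) (b j) = ((i == j) && D i)%:R.
Hypothesis c_orth : forall i j, dotp (c i) (c j) = ((i == j) && D i)%:R.
Implicit Types u v w : K.

Let coef v k : R := complex.Re (`|dotp v (b k)| ^+ 2).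

Let coefE v k : (coef v k)%:C = `|dotp v (b k)| ^+ 2.
Proof.
have [r hr] : exists r : R, `|dotp v (b k)| ^+ 2 = r%:C.
  by apply/complex_realP; rewrite ger0_real // exprn_ge0.
by rewrite /coef hr.
Qed.

Let coef_ge0 v k : 0 <= coef v k.
Proof. by rewrite -ler0c coefE exprn_ge0. Qed.

(** The family [d] is kept apart from [b]: taking [d = b] gives Bessel's inequality, taking [d = c]
    the convergence of the series defining the operator. *)
Lemma norm_orth_sum (d : nat -> K) v m n :
  (forall i j, dotp (d i) (d j) = ((i == j) && D i)%:R) ->
  `|\sum_(m <= k < n) dotp v (b k) *: d k| ^+ 2 =
  (\sum_(m <= k < n) coef v k)%:C.
Proof.
move=> d_orth; rewrite dotp_norm dotp_suml rmorph_sum /=; apply: eq_big_nat => i mi.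
rewrite dotpZl dotp_sumr (bigD1_seq i) ?mem_index_iota ?iota_uniq //=.
rewrite big1 => [|j ji]; last by rewrite dotpZr d_orth eq_sym (negbTE ji) mulr0.
rewrite addr0 dotpZr d_orth eqxx /= coefE normCK mulrA.
case Di : (D i); first by rewrite mulr1.
suff -> : b i = 0 by rewrite dotp0r !mul0r.
by apply: dotp_eq0; rewrite b_orth Di andbF.
Qed.

Lemma bessel v n : (\sum_(0 <= k < n) coef v k)%:C <= `|v| ^+ 2.
Proof.
set p := \sum_(0 <= k < n) dotp v (b k) *: b k.
have pp : dotp p p = (\sum_(0 <= k < n) coef v k)%:C.
  by rewrite -dotp_norm norm_orth_sum.
have vp : dotp v p = (\sum_(0 <= k < n) coef v k)%:C.
  rewrite dotp_sumr rmorph_sum /=; apply: eq_bigr => i _.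
  by rewrite dotpZr coefE normCK mulrC.
have pv : dotp p v = (\sum_(0 <= k < n) coef v k)%:C.
  by rewrite dotpC vp; apply: conj_Creal; apply/complex_realP; eexists.
have := exprn_ge0 2 (normr_ge0 (v - p)).
rewrite [X in 0 <= X]dotp_norm dotpBl !dotpBr pp vp pv subrr subr0 subr_ge0.
by rewrite -dotp_norm.
Qed.

(** The operator is [v |-> \sum_k <v, b_k> c_k], convergent by Bessel's inequality. Outside [D] both
    families vanish, which lets an enumeration skip indices. *)
Lemma partial_isometry_exists :
  exists2 T : K -> K, bounded_op T & forall i, T (b i) = c i.
Proof.
pose S v n := \sum_(0 <= k < n) dotp v (b k) *: c k.
have S_cvg v : cvgn (S v).
  apply: (@cvg_dominated _ _ _ (fun n => \sum_(0 <= k < n) coef v k) 1).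
    move=> m n mn; rewrite sum_nat_tail // norm_orth_sum //.
    by rewrite (big_cat_nat (leq0n m) mn) [X in X - _]addrC addrK.
  have [r r0 vr] := norm_real v.
  apply: nondecreasing_is_cvgn.
    move=> p q pq; rewrite [leRHS](big_cat_nat (leq0n p) pq) lerDl.
    by apply: sumr_ge0 => i _; exact: coef_ge0.
  exists (r ^+ 2) => _ [n _ <-].
  by have := bessel v n; rewrite vr -rmorphXn lecR.
exists (fun v => lim (S v n @[n --> \oo])).
  split=> [a u v|].
    have h : S (a *: u + v) n @[n --> \oo] -->
        a *: lim (S u n @[n --> \oo]) + lim (S v n @[n --> \oo]).
      have -> : S (a *: u + v) = fun n => a *: S u n + S v n.
        apply/funext => n; rewrite /S scaler_sumr -big_split /=.
        by apply: eq_bigr => i _; rewrite dotpDl dotpZl scalerDl scalerA.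
      by apply: cvgD; [apply: cvgZl_tmp|]; exact: S_cvg.
    exact: cvg_lim h.
  exists 1 => v; rewrite mul1r; have [r r0 vr] := norm_real v; rewrite vr.
  apply: norm_lim_le (S_cvg v) _ => n.
  rewrite -(@ler_pXn2r _ 2) ?nnegrE ?ler0c //.
  by rewrite norm_orth_sum // (le_trans (bessel _ _)) // vr.
move=> i; apply: cvg_lim => //; apply: cvg_near_cst; exists i.+1 => // n /= ni.
rewrite /S (bigD1_seq i) ?mem_index_iota ?iota_uniq //=.
rewrite big1 ?addr0 => [|j ji].
  rewrite b_orth eqxx /=; case Di : (D i); first by rewrite scale1r.
  by rewrite scale0r; apply/esym/dotp_eq0; rewrite c_orth Di andbF.
by rewrite b_orth eq_sym (negbTE ji) scale0r.
Qed.

End PartialIsometry.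

Section Fock.
Context {R : realType} {H : hilbert R} {F : full_fock H}.
Implicit Types (s t : seq H) (xi eta : H).

Lemma dotp_tens_cons xi eta s t :
  dotp (tens F (xi :: s)) (tens F (eta :: t)) =
  dotp xi eta * dotp (tens F s) (tens F t).
Proof. by rewrite !dotp_tens /= eqSS; case: ifP; rewrite ?mulr0 // big_cons. Qed.

Lemma norm_tens_cons xi s : `|tens F (xi :: s)| = `|xi| * `|tens F s|.
Proof.
apply/eqP; rewrite -(@eqrXn2 _ 2) ?mulr_ge0 // exprMn.
by rewrite 2!dotp_norm [X in _ == _ * X]dotp_norm dotp_tens_cons.
Qed.

(** Multilinearity is hidden in the inner product formula: the defect [d] is orthogonal to all
    simple tensors, and being a combination of three of them it is orthogonal to itself. *)
Lemma tens_cons_linear s : linear (fun xi => tens F (xi :: s)).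
Proof.
move=> a xi eta; apply/eqP; rewrite -subr_eq0; apply/eqP.
set d := _ - _; have d0 t : dotp d (tens F t) = 0.
  rewrite /d dotpBl dotpDl dotpZl; case: t => [|zeta t].
    by rewrite !dotp_tens /= mulr0 addr0 subr0.
  by rewrite !dotp_tens_cons dotpDl dotpZl mulrDl -mulrA subrr.
by apply: dotp_eq0; rewrite {2}/d dotpBr dotpDr dotpZr !d0 mulr0 addr0 subr0.
Qed.

Lemma tens_cons_continuous s : continuous (fun xi => tens F (xi :: s)).
Proof.
have [c c0 sc] := norm_real (tens F s).
apply: (@lipschitz_bound_continuous _ _ _ _ c) => xi eta.
have -> : tens F (xi :: s) - tens F (eta :: s) = tens F ((xi - eta) :: s).
  have := tens_cons_linear s (-1) eta xi.
  by rewrite !scaleN1r (addrC (- eta)) (addrC (- tens _ _)) => ->.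
by rewrite norm_tens_cons sc mulrC.
Qed.

Variables (Theta : set nat) (e : nat -> H) (l : nat -> F -> F).
Hypothesis he : orthonormal_basis Theta e.
Hypothesis hl : forall i, Theta i -> left_creation (e i) (l i).

Definition letters (W : seq nat) := all (fun i => i \in Theta) W.
Definition word (W : seq nat) : F := tens F (map e W).

Lemma l_word i W : Theta i -> l i (word W) = word (i :: W).
Proof. by move=> /hl[_ lW]; exact: lW. Qed.

Lemma left_creation_bounded i : Theta i -> bounded_op (l i).
Proof. by move=> /hl[]. Qed.

Lemma letters_rcons V k : letters (rcons V k) = letters V && (k \in Theta).
Proof. by rewrite /letters all_rcons andbC. Qed.

Lemma dotp_word V W : letters V -> letters W ->
  dotp (word V) (word W) = (V == W)%:R.
Proof.
elim: V W => [|i V IH] [|j W] /=; rewrite /word /=.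
- by move=> _ _; rewrite dotp_tens big_nil.
- by rewrite dotp_tens.
- by rewrite dotp_tens.
move=> /andP[]; rewrite inE => Ti lV /andP[]; rewrite inE => Tj lW.
rewrite dotp_tens_cons IH // he.1 // eqseq_cons.
by case: (i == j); rewrite ?mul1r ?mul0r.
Qed.

(** Totality of the simple tensors must be reduced to that of the words. A given [D] need not be
    stable under the [l i], but the smallest closed subspace [M] containing the words is, because
    preimages of good sets under [l i] are good. Hence, by induction on the length, [M] contains
    [e_i (x) s = l_i s], and by density of the span of the [e_i] every [xi (x) s]. *)
Lemma word_total (D : set F) : closed D -> D 0 ->
  (forall c u v, D u -> D v -> D (c *: u + v)) ->
  (forall W, letters W -> D (word W)) -> forall v, D v.
Proof.
move=> Dcl D0 Dlin DW.
pose good (E : set F) := [/\ closed E, E 0,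
  forall c u v, E u -> E v -> E (c *: u + v) & forall W, letters W -> E (word W)].
pose M : set F := [set v | forall E, good E -> E v].
have Mcl : closed M.
  move=> v Mv E gE; have [Ecl _ _ _] := gE; apply: Ecl.
  by apply: closure_subset Mv => w; apply.
have M0 : M 0 by move=> E [].
have Mlin c u v : M u -> M v -> M (c *: u + v).
  by move=> Mu Mv E gE; have [_ _ Elin _] := gE; apply: Elin; [exact: Mu|exact: Mv].
have lM i v : Theta i -> M v -> M (l i v).
  move=> Ti Mv E [Ecl E0 Elin EW]; have bl := left_creation_bounded Ti.
  apply: (Mv [set w | E (l i w)]); split.
  - exact: (continuous_closedP _).1 (bounded_op_continuous bl) _ Ecl.
  - by rewrite /= bounded_op0.
  - by move=> c u w /= Eu Ew; rewrite bounded_opP //; exact: Elin.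
  - by move=> W lW /=; rewrite l_word //; apply: EW; rewrite /= mem_set.
suff Mtens s : M (tens F s).
  have Mall : forall v, M v.
    apply: (closed_subspace_total (tens_total F)) => // _ [s _ <-]; exact: Mtens.
  by move=> v; apply: Mall.
elim: s => [|xi s IH]; first by move=> E [_ _ _ /(_ [::])]; apply.
apply: (closed_subspace_total he.2 (D := [set xi | M (tens F (xi :: s))])).
- exact: (continuous_closedP _).1 (@tens_cons_continuous s) _ Mcl.
- rewrite /=; suff -> : tens F (0 :: s) = 0 by [].
  by apply/eqP; rewrite -normr_eq0 norm_tens_cons normr0 mul0r.
- by move=> c u v /= Mu Mv; rewrite (tens_cons_linear s c u v); exact: Mlin.
- move=> _ [i Ti <-] /=; have [_ <-] := hl Ti; exact: lM.
Qed.

Lemma word_ext (T S : F -> F) : bounded_op T -> bounded_op S ->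
  (forall W, letters W -> T (word W) = S (word W)) -> T =1 S.
Proof.
move=> bT bS TS; apply: word_total => //.
- by apply: closed_eq_fun; exact: bounded_op_continuous.
- by rewrite /= !bounded_op0.
- by move=> c u v /= Tu Tv; rewrite !bounded_opP // Tu Tv.
Qed.

Lemma dotp_word_ext (T S : F -> F) a : bounded_op T -> bounded_op S ->
  (forall V W, letters V -> letters W ->
     dotp (T (word V)) (S (word W)) = a * dotp (word V) (word W)) ->
  forall u v, dotp (T u) (S v) = a * dotp u v.
Proof.
move=> bT bS TS; have TSr V : letters V ->
    forall v, dotp (T (word V)) (S v) = a * dotp (word V) v.
  move=> lV; apply: word_total; last by move=> W lW; exact: TS.
  - apply: (@closed_eq_fun _ _ R[i]^o) => v.
      have h := @dotpr_continuous _ _ (T (word V)) (S v).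
      exact: (@continuous_comp _ _ R[i]^o S (dotp (T (word V))) v
        (@bounded_op_continuous _ _ _ bS v) h).
    rewrite (_ : (fun w => _) = dotp (a *: word V)); first exact: dotpr_continuous.
    by apply/funext => w; rewrite dotpZl.
  - by rewrite /= bounded_op0 // !dotp0r mulr0.
  - move=> c u v /= Tu Tv.
    by rewrite bounded_opP // !dotpDr !dotpZr Tu Tv mulrDr mulrCA.
move=> u v; move: u; apply: word_total; last by move=> V lV; exact: TSr.
- apply: (@closed_eq_fun _ _ R[i]^o) => u.
    have h := @dotpl_continuous _ _ (S v) (T u).
    exact: (@continuous_comp _ _ R[i]^o T (fun w => dotp w (S v)) u
      (@bounded_op_continuous _ _ _ bT u) h).
  rewrite (_ : (fun w => _) = fun w => dotp w (Num.conj a *: v)).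
    exact: dotpl_continuous.
  by apply/funext => w; rewrite dotpZr conjCK.
- by rewrite /= bounded_op0 // !dotp0l mulr0.
- move=> c u w /= Tu Tv.
  by rewrite bounded_opP // !dotpDl !dotpZl Tu Tv mulrDr mulrCA.
Qed.

Lemma left_creation_isometry i u v : Theta i ->
  dotp (l i u) (l i v) = dotp u v.
Proof.
move=> Ti; have bl := left_creation_bounded Ti; rewrite -[RHS]mul1r.
apply: dotp_word_ext => // V W lV lW.
by rewrite !l_word // mul1r !dotp_word //= ?mem_set // eqseq_cons eqxx.
Qed.

(** The operator [eta |-> eta (x) e_j]; by [word_ext] its values on words determine it. *)
Definition right_creation (j : nat) (r : F -> F) :=
  bounded_op r /\ forall W, letters W -> r (word W) = word (rcons W j).

Lemma right_creation_exists j : Theta j -> exists r, right_creation j r.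
Proof.
move=> Tj.
(* Words are enumerated by their codes; an index that codes no word over [Theta] receives the zero
   vector and is excluded from [D]. *)
pose fam (f : seq nat -> F) k :=
  if pickle_inv k is Some W then if letters W then f W else 0 else 0.
pose D k := if @pickle_inv (seq nat) k is Some W then letters W else false.
have fam_orth f :
    (forall V W, letters V -> letters W -> dotp (f V) (f W) = (V == W)%:R) ->
    forall i k, dotp (fam f i) (fam f k) = ((i == k) && D i)%:R.
  move=> f_orth i k; rewrite /fam /D; have [<-|ik] := eqVneq i k => /=.
    case: (pickle_inv i) => [V|]; last by rewrite dotp0l.
    by case: ifP => lV; rewrite ?dotp0l // f_orth ?eqxx.
  have := @pickle_invK (seq nat) i; have := @pickle_invK (seq nat) k.
  case: (pickle_inv k) => [W|] /=; last by rewrite dotp0r.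
  case: (pickle_inv i) => [V|] /=; last by rewrite dotp0l.
  move=> Wk Vi; case: ifP => lV; last by rewrite dotp0l.
  case: ifP => lW; last by rewrite dotp0r.
  by rewrite f_orth //; case: eqP => // VW; rewrite -Wk -Vi VW eqxx in ik.
have [||r br rE] := @partial_isometry_exists _ _ D (fam word)
    (fam (fun W => word (rcons W j))).
- by apply: fam_orth; exact: dotp_word.
- apply: fam_orth => V W lV lW; rewrite dotp_word ?eqseq_rcons ?eqxx ?andbT //.
    by rewrite letters_rcons lV mem_set.
  by rewrite letters_rcons lW mem_set.
exists r; split=> // W lW; have := rE (pickle W).
by rewrite /fam pickleK_inv lW.
Qed.

Lemma right_creation_comm j r i v : Theta j -> Theta i -> right_creation j r ->
  r (l i v) = l i (r v).
Proof.
move=> Tj Ti [br rE]; have bl := left_creation_bounded Ti.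
move: v; apply: (word_ext (T := r \o l i) (S := l i \o r)) => [||W lW].
- exact: bounded_op_comp.
- exact: bounded_op_comp.
- by rewrite /= l_word // !rE ?l_word //= mem_set.
Qed.

Lemma dotp_right_creation j k r r' u v : Theta j -> Theta k ->
  right_creation j r -> right_creation k r' ->
  dotp (r u) (r' v) = (j == k)%:R * dotp u v.
Proof.
move=> Tj Tk [br rE] [br' rE']; apply: dotp_word_ext => // V W lV lW.
rewrite rE // rE' // !dotp_word //; last 2 first.
  by rewrite letters_rcons lV mem_set.
  by rewrite letters_rcons lW mem_set.
by rewrite eqseq_rcons -natrM mulnb andbC.
Qed.

End Fock.

(** * Peripheral eigenspaces *)

Lemma norm_complex_le (R : realType) (z : R[i]) :
  `|z| <= (`|complex.Re z| + `|complex.Im z|)%:C.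
Proof.
rewrite normc_def lecR -(@ler_pXn2r _ 2) ?nnegrE ?sqrtr_ge0 ?addr_ge0 //.
rewrite sqr_sqrtr ?addr_ge0 ?sqr_ge0 // sqrrD !real_normK ?num_real //.
by rewrite -addrA lerD2l lerDr mulrn_wge0 // mulr_ge0.
Qed.

Lemma truncn_dist (R : realType) (s t : R) : 0 <= s -> 0 <= t ->
  Num.truncn s = Num.truncn t -> `|s - t| < 1.
Proof.
move=> /truncn_itv/andP[s1 s2] /truncn_itv/andP[t1 t2] st.
rewrite st -natr1 in s1 s2; rewrite -natr1 in t2; rewrite ltr_norml.
by apply/andP; split; lra.
Qed.

(* Dirichlet: among the powers of (lambda_k)_k two fall in the same box of a
   grid of mesh 1/q, and their quotient is close to 1. *)
Lemma unit_recurrence (R : realType) n (lambda : 'I_n -> R[i]) (eps : R) N :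
  (forall k, `|lambda k| = 1) -> 0 < eps ->
  exists2 m, (N <= m)%N & forall k, `|lambda k ^+ m - 1| < eps%:C.
Proof.
move=> lambda1 eps0.
(* The 2 accounts for the real and the imaginary part, each of which will move by less than
   [1/q]. *)
pose q := (Num.truncn (2 / eps)).+1.
have q0 : 0 < q%:R :> R by rewrite ltr0n.
have qeps : 2 / q%:R <= eps.
  rewrite ler_pdivrMr // mulrC -ler_pdivrMr // /q.
  by have /truncn_itv/andP[_ /ltW] : 0 <= 2 / eps by rewrite divr_ge0 // ltW.
(* Working with powers of [lambda k ^+ N.+1] makes any positive exponent found for [mu] an exponent
   at least [N] for [lambda]. *)
pose mu k := lambda k ^+ N.+1.
have mu1 k m : `|mu k ^+ m| = 1 by rewrite !normrX lambda1 !expr1n.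
have coord (z : R[i]) : `|z| = 1 ->
    [/\ -1 <= complex.Re z, complex.Re z <= 1,
        -1 <= complex.Im z & complex.Im z <= 1].
  move=> z1; have := add_Re2_Im2 z; rewrite z1 expr1n -(rmorph1 (real_complex R)).
  by move=> /complexI h; split; nra.
(* The extra cell is for [t = 1], where [(t + 1) * q] reaches [2 * q]. *)
pose cell (t : R) : 'I_(2 * q).+1 := inord (Num.truncn ((t + 1) * q%:R)).
have cell_lt (t : R) : -1 <= t -> t <= 1 ->
    (Num.truncn ((t + 1) * q%:R) < (2 * q).+1)%N.
  move=> t1 t2; have t0 : 0 <= (t + 1) * q%:R by rewrite mulr_ge0 //; lra.
  rewrite ltnS -(ler_nat R); have /andP[/le_trans h _] := truncn_itv t0.
  by apply: h; rewrite natrM ler_wpM2r //; lra.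
have cellP s t : -1 <= s -> s <= 1 -> -1 <= t -> t <= 1 -> cell s = cell t ->
    `|s - t| < q%:R^-1.
  move=> s1 s2 t1 t2 /(congr1 val) /=; rewrite !inordK ?cell_lt // => st.
  have : `|(s + 1) * q%:R - (t + 1) * q%:R| < 1.
    by apply: truncn_dist st; rewrite mulr_ge0 //; lra.
  rewrite -mulrBl opprD addrACA subrr addr0 normrM (gtr0_norm q0).
  by rewrite -ltr_pdivlMr // mul1r.
pose f (a : 'I_#|{ffun 'I_n -> 'I_(2 * q).+1 * 'I_(2 * q).+1}|.+1) :=
  [ffun k => (cell (complex.Re (mu k ^+ a)), cell (complex.Im (mu k ^+ a)))].
have /injectivePn[a [b ab fab]] : ~~ injectiveb f.
  by apply/injectiveP => /leq_card; rewrite card_ord ltnn.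
wlog lt_ab : a b ab fab / (a < b)%N.
  move=> h; have := ab; rewrite neq_ltn => /orP[lt_ab|lt_ba]; first exact: h lt_ab.
  by apply: h lt_ba => //; rewrite eq_sym.
exists (N.+1 * (b - a))%N.
  by rewrite (leq_trans (leqnSn N)) // leq_pmulr // subn_gt0.
move=> k; rewrite exprM -/(mu k).
have -> : `|mu k ^+ (b - a) - 1| = `|mu k ^+ b - mu k ^+ a|.
  rewrite (_ : mu k ^+ b - _ = mu k ^+ a * (mu k ^+ (b - a) - 1)).
    by rewrite normrM mu1 mul1r.
  by rewrite mulrBr mulr1 -exprD subnKC // ltnW.
apply: le_lt_trans (norm_complex_le _) _; rewrite ltcR.
have [ra1 ra2 ia1 ia2] := coord _ (mu1 k a).
have [rb1 rb2 ib1 ib2] := coord _ (mu1 k b).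
move/ffunP/(_ k): fab; rewrite !ffunE => -[/esym reE /esym imE].
apply: lt_le_trans qeps; rewrite mulr2n mulrDl mul1r !raddfB.
by apply: ltrD; apply: cellP.
Qed.

(** * Density of the span of the peripheral eigenvectors *)

Section Peripheral.
Context {R : realType} {K : hilbert R}.
Variable P : (K -> K) -> (K -> K).
Implicit Types (x y z T : K -> K) (u v w : K).

Local Notation eigens :=
  (\bigcup_(lambda in [set z : R[i] | `|z| = 1]) Defs.eigenspace P lambda).

Lemma bounded_op_zero : bounded_op (0 : K -> K).
Proof.
by split=> [c u v|]; [rewrite scaler0 addr0|exists 0 => v; rewrite mul0r normr0].
Qed.

Lemma span_eigens_bounded x : lin_span eigens x -> bounded_op x.
Proof.
move=> [n [c [a [aE ->]]]]; elim/big_ind: _ => [|y z by_ bz|k _].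
- exact: bounded_op_zero.
- by rewrite -[y]scale1r; exact: bounded_op_lin.
- rewrite -[_ *: _]addr0; apply: bounded_op_lin; last exact: bounded_op_zero.
  by have [lambda _ []] := aE k.
Qed.

Lemma op_norm_subrr x : op_norm (x - x) = 0.
Proof.
rewrite subrr; apply/eqP; rewrite eq_le op_norm_ge0 ?andbT.
  by apply: op_norm_le => // v; rewrite mul0r normr0.
exact: bounded_op_zero.
Qed.

Lemma op_normB x y : op_norm (x - y) = op_norm (y - x).
Proof.
have E v : `|(x - y) v| = `|(y - x) v| by exact: (distrC (x v) (y v)).
rewrite /op_norm; congr (inf _); apply/seteqP.
by split=> c [c0 xc]; split=> // v; [rewrite -E|rewrite E].
Qed.

Lemma span_eigens_peripheral x : lin_span eigens x -> peripheral_boundary P x.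
Proof.
move=> sx; split; first exact: span_eigens_bounded.
by move=> eps e0; exists x => //; rewrite op_norm_subrr.
Qed.

Lemma span_eigens_lin a x y : lin_span eigens x -> lin_span eigens y ->
  lin_span eigens (a *: x + y).
Proof.
move=> [n [c [f [fE ->]]]] [m [d [g [gE ->]]]].
pose h (A : Type) (p : 'I_n -> A) (q : 'I_m -> A) (k : 'I_(n + m)) :=
  match fintype.split k with inl i => p i | inr j => q j end.
exists (n + m)%N, (h _ (fun i => a * c i) d), (h _ f g); split.
  by move=> k; rewrite /h; case: (fintype.split k).
rewrite big_split_ord /= scaler_sumr; congr (_ + _); apply: eq_bigr => i _.
  by rewrite /h (unsplitK (inl i)) scalerA.
by rewrite /h (unsplitK (inr i)).
Qed.

Lemma eigenspace_span lambda x : `|lambda| = 1 -> Defs.eigenspace P lambda x ->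
  lin_span eigens x.
Proof.
move=> l1 ex; exists 1%N, (fun=> 1), (fun=> x); split; first by move=> _; exists lambda.
by rewrite big_ord1 scale1r.
Qed.

Lemma dotp_op_norm T u w : bounded_op T ->
  `|dotp (T u) w| <= (op_norm T)%:C * (`|u| * `|w|).
Proof.
move=> bT; rewrite (le_trans (dotp_le _ _)) // mulrA ler_wpM2r //.
exact: op_norm_bound.
Qed.

Lemma bounded_op_sub x y : bounded_op x -> bounded_op y -> bounded_op (x - y).
Proof. by move=> bx by_; rewrite addrC -scaleN1r; exact: bounded_op_lin. Qed.

(** Reduces identities about the product to eigenvectors, where it is an explicit limit. [Phi] will
    be left or right multiplication by a fixed element of the Poisson boundary. *)
Lemma peripheral_dotp_eq (Phi : (K -> K) -> (K -> K)) a u w u' w' :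
  (forall x, peripheral_boundary P x -> peripheral_boundary P (Phi x)) ->
  (forall c x y, peripheral_boundary P x -> peripheral_boundary P y ->
     Phi (c *: x + y) = c *: Phi x + Phi y) ->
  (forall x, peripheral_boundary P x -> forall eps : R, 0 < eps ->
     exists2 delta : R, 0 < delta & forall y, peripheral_boundary P y ->
       op_norm (y - x) < delta -> op_norm (Phi y - Phi x) < eps) ->
  (forall lambda x, `|lambda| = 1 -> Defs.eigenspace P lambda x ->
     dotp (Phi x u) w = a * dotp (x u') w') ->
  forall x, peripheral_boundary P x -> dotp (Phi x u) w = a * dotp (x u') w'.
Proof.
move=> Phicl Philin Phicont Phieig.
have Phi0 : Phi 0 = 0.
  have p0 : peripheral_boundary P 0.
    apply: span_eigens_peripheral; exists 0%N, (fun=> 0), (fun=> 0).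
    by split=> [[]//|]; rewrite big_ord0.
  by have := Philin (-1) _ _ p0 p0; rewrite scaler0 addr0 scaleN1r addNr.
have Phispan x : lin_span eigens x -> dotp (Phi x u) w = a * dotp (x u') w'.
  move=> [n [c [f [fE ->]]]].
  (* Membership in the span is carried through the induction because [Philin] applies only to
     peripheral elements. *)
  suff [] : lin_span eigens (\sum_(k < n) c k *: f k) /\
    dotp (Phi (\sum_(k < n) c k *: f k) u) w =
    a * dotp ((\sum_(k < n) c k *: f k) u') w' by [].
  elim: n c f fE => [|n IH] c f fE.
    rewrite big_ord0 Phi0 !dotp0l mulr0; split=> //.
    by exists 0%N, (fun=> 0), (fun=> 0); split=> [[]//|]; rewrite big_ord0.
  have [|sIH eIH] := IH (fun k => c (lift ord0 k)) (fun k => f (lift ord0 k)).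
    by move=> k; exact: fE.
  have [lambda l1 el] := fE ord0; have sf := eigenspace_span l1 el.
  rewrite big_ord_recl; split; first exact: span_eigens_lin.
  rewrite Philin; [|exact: span_eigens_peripheral..].
  set s := \sum_(i < n) _ in eIH *.
  rewrite (_ : (c ord0 *: Phi (f ord0) + Phi s) u =
    c ord0 *: Phi (f ord0) u + Phi s u) //.
  rewrite (_ : (c ord0 *: f ord0 + s) u' = c ord0 *: f ord0 u' + s u') //.
  by rewrite !dotpDl !dotpZl eIH (Phieig _ _ l1 el) mulrDr mulrCA.
move=> x px; have [bx xcl] := px; have bPx : bounded_op (Phi x) := (Phicl _ px).1.
have [p p0 up] : exists2 p : R, 0 <= p & `|u| * `|w| = p%:C.
  have [[r r0 ->] [t t0 ->]] := (norm_real u, norm_real w).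
  by exists (r * t); rewrite ?mulr_ge0 // rmorphM.
have [q q0 uq] : exists2 q : R, 0 <= q & `|a| * (`|u'| * `|w'|) = q%:C.
  have [[r r0 ->] [t t0 ->]] := (norm_real u', norm_real w').
  have /complex_realP [b ab] : `|a| \is Num.real by exact: normr_real.
  exists (b * (r * t)); last by rewrite ab !rmorphM.
  by rewrite !mulr_ge0 // -ler0c -ab.
apply/eqP; rewrite -subr_eq0 -normr_eq0.
have /complex_realP [d dE] :
  `|dotp (Phi x u) w - a * dotp (x u') w'| \is Num.real by exact: normr_real.
rewrite dE; suff -> : d = 0 by [].
apply/eqP; rewrite eq_le -(ler0c d) -dE normr_ge0 andbT.
apply/ler_addgt0Pr => e e0; rewrite add0r.
(* The two sides contribute errors at most [e' * p] and [e' * q]; the added 1 keeps the denominator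
   positive. *)
pose e' := e / (p + q + 1).
have e'0 : 0 < e' by rewrite divr_gt0 // ltr_wpDl // addr_ge0.
have [delta delta0 hdelta] := Phicont x px e' e'0.
(* The approximant must be [delta]-close to control [Phi x] and [e']-close to control [x] itself. *)
have min0 : 0 < Num.min delta e' by rewrite lt_min delta0.
have [y sy] := xcl _ min0; rewrite lt_min op_normB => /andP[xy1 xy2].
have py := span_eigens_peripheral sy; have by_ := span_eigens_bounded sy.
have bPy : bounded_op (Phi y) := (Phicl _ py).1.
have := ltW (hdelta _ py xy1); rewrite op_normB => Pxy.
rewrite -lecR -dE.
have -> : dotp (Phi x u) w - a * dotp (x u') w' =
   dotp ((Phi x - Phi y) u) w + a * dotp ((y - x) u') w'.
  rewrite (_ : (Phi x - Phi y) u = Phi x u - Phi y u) //.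
  rewrite (_ : (y - x) u' = y u' - x u') //.
  by rewrite !dotpBl (Phispan y sy) mulrBr addrA subrK.
rewrite (le_trans (ler_normD _ _)) // normrM.
apply: (@le_trans _ _ (e'%:C * p%:C + e'%:C * q%:C)).
  apply: lerD.
    rewrite (le_trans (dotp_op_norm _ _ (bounded_op_sub bPx bPy))) // up.
    by rewrite ler_wpM2r ?ler0c // lecR.
  apply: (@le_trans _ _ (`|a| * (e'%:C * (`|u'| * `|w'|)))); last first.
    by rewrite mulrCA uq.
  rewrite ler_wpM2l // (le_trans (dotp_op_norm _ _ (bounded_op_sub by_ bx))) //.
  by rewrite ler_wpM2r ?mulr_ge0 // lecR ltW.
rewrite -mulrDr -rmorphD -rmorphM lecR /e' mulrAC ler_pdivrMr ?ltr_wpDl ?addr_ge0 //.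
by rewrite ler_wpM2l ?ltW // ltrDl.
Qed.

End Peripheral.

(** * Recurrence of coefficients and products with operators commuting with the [l i] *)

Section PeripheralTransfer.
Context {R : realType} {K : hilbert R}.
Variables (Theta : set nat) (omega : nat -> R) (l l_adj : nat -> K -> K).
Hypothesis omega_ge0 : forall i, Theta i -> 0 <= omega i.
Hypothesis omega_sum :
  (fun n => \sum_(0 <= i < n | i \in Theta) omega i) @ \oo --> (1 : R).
Hypothesis l_bounded : forall i, Theta i -> bounded_op (l i).
Hypothesis l_isometry : forall i u v, Theta i -> dotp (l i u) (l i v) = dotp u v.
Hypothesis l_adjoint : forall i, Theta i -> is_adjoint (l i) (l_adj i).

Local Notation P := (weighted_transfer Theta omega l l_adj).
Implicit Types (x y z r : K -> K) (u v w : K).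

Lemma iter_transfer_sum m n (c : 'I_n -> R[i]) (f : 'I_n -> K -> K) :
  (forall k, bounded_op (f k)) ->
  iter m P (\sum_(k < n) c k *: f k) = \sum_(k < n) c k *: iter m P (f k).
Proof.
elim: n c f => [|n IH] c f bf.
  by rewrite !big_ord0; elim: m => //= m ->; rewrite transfer0.
rewrite !big_ord_recl iter_transfer_lin // ?IH //.
elim/big_ind: _ => [|y z by_ bz|k _]; first exact: bounded_op_zero.
  by rewrite -[y]scale1r; exact: bounded_op_lin.
by rewrite -[_ *: _]addr0; apply: bounded_op_lin => //; exact: bounded_op_zero.
Qed.

(* [m |-> P^m x] is almost periodic, so its coefficients recur. *)
Lemma peripheral_dotp_eq0 x u w : peripheral_boundary P x ->
  (forall e : R, 0 < e -> exists N, forall m, (N <= m)%N ->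
     `|dotp (iter m P x u) w| <= e%:C) ->
  dotp (x u) w = 0.
Proof.
move=> [bx xcl] x0.
have [p p0 up] : exists2 p : R, 0 <= p & `|u| * `|w| = p%:C.
  have [[r r0 ->] [t t0 ->]] := (norm_real u, norm_real w).
  by exists (r * t); rewrite ?mulr_ge0 // rmorphM.
apply/eqP; rewrite -normr_eq0.
have /complex_realP [d dE] : `|dotp (x u) w| \is Num.real by exact: normr_real.
rewrite dE; suff -> : d = 0 by [].
apply/eqP; rewrite eq_le -(ler0c d) -dE normr_ge0 andbT.
apply/ler_addgt0Pr => e e0; rewrite add0r -lecR -dE.
(* With [y] a combination of eigenvectors near [x], four errors arise: the coefficients of [x - y],
   of [P^m (x - y)], of [P^m y - y] and of [P^m x]. Recurrence makes the third small at some
   [m >= N], where the hypothesis makes the fourth small. *)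
have e40 : 0 < e / 4 by rewrite divr_gt0.
have [N hN] := x0 _ e40.
have ep0 : 0 < e / 4 / (p + 1) by rewrite divr_gt0 // ltr_wpDl.
have [y [n [c [f [fE yE]]]] xy] := xcl _ ep0.
have /choice [lambda lambdaE] : forall k, exists mu : R[i], `|mu| = 1 /\ Defs.eigenspace P mu (f k).
  by move=> k; have [mu mu1 emu] := fE k; exists mu.
have bf k : bounded_op (f k) by have [_ []] := lambdaE k.
have by_ : bounded_op y.
  by apply: (@span_eigens_bounded _ _ P); exists n, c, f.
have bxy : bounded_op (x - y) by exact: bounded_op_sub.
have [S S0 SE] : exists2 S : R, 0 <= S &
    \sum_(k < n) `|c k * dotp (f k u) w| = S%:C.
  have /complex_realP [S SE] : \sum_(k < n) `|c k * dotp (f k u) w| \is Num.real.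
    by rewrite ger0_real // sumr_ge0.
  by exists S => //; rewrite -ler0c -SE sumr_ge0.
have eS0 : 0 < e / 4 / (S + 1) by rewrite divr_gt0 // ltr_wpDl.
have [m Nm hm] := unit_recurrence N (fun k => (lambdaE k).1) eS0.
have xy_le (T : K -> K) : bounded_op T ->
    (forall v, `|T v| <= (op_norm (x - y))%:C * `|v|) ->
    `|dotp (T u) w| <= (e / 4)%:C.
  move=> bT Txy; rewrite (le_trans (dotp_op_norm _ _ bT)) // up -rmorphM lecR.
  have : op_norm T <= e / 4 / (p + 1).
    by apply: le_trans (ltW xy); apply: op_norm_le => //; exact: op_norm_ge0.
  rewrite ler_pdivlMr ?ltr_wpDl // => /(le_trans _); apply.
  by rewrite ler_wpM2l ?op_norm_ge0 // lerDl.
have h1 : `|dotp ((x - y) u) w| <= (e / 4)%:C.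
  by apply: xy_le => // v; exact: op_norm_bound.
have h2 : `|dotp (iter m P (x - y) u) w| <= (e / 4)%:C.
  apply: xy_le => [|v]; first exact: iter_transfer_bounded.
  by apply: iter_transfer_bound => //; [exact: op_norm_ge0|move=> ?; exact: op_norm_bound].
have h3 := hN _ Nm.
have h4 : `|dotp (iter m P y u) w - dotp (y u) w| <= (e / 4)%:C.
  have yu (g : 'I_n -> K -> K) : dotp ((\sum_(k < n) c k *: g k) u) w =
      \sum_(k < n) c k * dotp (g k u) w.
    rewrite fct_sumE dotp_suml; apply: eq_bigr => k _.
    by rewrite (_ : (c k *: g k) u = c k *: g k u) // dotpZl.
  rewrite yE iter_transfer_sum // !yu -sumrB.
  apply: (@le_trans _ _ (\sum_(k < n) `|c k * dotp (f k u) w| * (e / 4 / (S + 1))%:C)).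
    rewrite (le_trans (ler_norm_sum _ _ _)) //; apply: ler_sum => k _.
    have -> : iter m P (f k) = lambda k ^+ m *: f k.
      by apply: iter_transfer_eigen => //; have [] := lambdaE k.
    rewrite (_ : (lambda k ^+ m *: f k) u = lambda k ^+ m *: f k u) // dotpZl.
    rewrite mulrCA -[X in _ - X]mul1r -mulrBl normrM mulrC ler_wpM2l //.
    exact: ltW (hm k).
  rewrite -mulr_suml SE -rmorphM lecR mulrA ler_pdivrMr ?ltr_wpDl // mulrC.
  by rewrite ler_wpM2l ?(ltW e40) // lerDl.
have -> : dotp (x u) w = dotp ((x - y) u) w
    - (dotp (iter m P y u) w - dotp (y u) w)
    + dotp (iter m P x u) w - dotp (iter m P (x - y) u) w.
  have -> : iter m P (x - y) = iter m P x - iter m P y.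
    by rewrite addrC -scaleN1r iter_transfer_lin // scaleN1r addrC.
  rewrite (_ : (x - y) u = x u - y u) //.
  rewrite (_ : (iter m P x - iter m P y) u = iter m P x u - iter m P y u) //.
  by rewrite !dotpBl; ring.
rewrite (le_trans (ler_normB _ _)) // (_ : e = e / 4 + e / 4 + e / 4 + e / 4).
  rewrite !rmorphD; apply: lerD => //; rewrite (le_trans (ler_normD _ _)) //.
  by apply: lerD => //; rewrite (le_trans (ler_normB _ _)) // lerD.
by field.
Qed.

Variable circ : (K -> K) -> (K -> K) -> (K -> K).
Hypothesis hcirc : modified_choi_effros P circ.

Lemma commuting_poisson r : bounded_op r ->
  (forall i v, Theta i -> r (l i v) = l i (r v)) -> poisson_boundary P r.
Proof.
move=> br rl; split=> //; rewrite scale1r; exact: transfer_commuting.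
Qed.

Lemma poisson_peripheral r : poisson_boundary P r -> peripheral_boundary P r.
Proof.
by move=> pr; apply/span_eigens_peripheral/(eigenspace_span _ pr); rewrite normr1.
Qed.

Lemma circ_continuousl r : peripheral_boundary P r ->
  forall x, peripheral_boundary P x -> forall eps : R, 0 < eps ->
    exists2 delta : R, 0 < delta & forall y, peripheral_boundary P y ->
      op_norm (y - x) < delta -> op_norm (circ y r - circ x r) < eps.
Proof.
move=> pr x px eps e0; have [d d0 hd] := circ_continuous hcirc px pr e0.
by exists d => // y py yx; apply: hd => //; rewrite op_norm_subrr.
Qed.

Lemma circ_continuousr r : peripheral_boundary P r ->
  forall x, peripheral_boundary P x -> forall eps : R, 0 < eps ->
    exists2 delta : R, 0 < delta & forall y, peripheral_boundary P y ->
      op_norm (y - x) < delta -> op_norm (circ r y - circ r x) < eps.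
Proof.
move=> pr x px eps e0; have [d d0 hd] := circ_continuous hcirc pr px e0.
by exists d => // y py yx; apply: hd => //; rewrite op_norm_subrr.
Qed.

(** For an eigenvector [y], [P^m(y r) = P^m(y) r = lambda^m y r], so the sequence defining the
    product is constant. *)
Lemma dotp_circ_commuting x r u w : peripheral_boundary P x -> bounded_op r ->
  (forall i v, Theta i -> r (l i v) = l i (r v)) ->
  dotp (circ x r u) w = dotp (x (r u)) w.
Proof.
move=> px br rl; have pr := commuting_poisson br rl.
have ppr := poisson_peripheral pr; rewrite -[RHS]mul1r.
apply: (peripheral_dotp_eq (P := P) (Phi := circ^~ r)) px.
- by move=> y py; exact: circ_closed hcirc _ _ py ppr.
- by move=> c y z py pz; exact: (circ_linearl hcirc).
- exact: circ_continuousl.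
move=> lambda y l1 ey; rewrite mul1r.
suff -> : circ y r u = y (r u) by [].
have h := circ_eigenspace hcirc l1 (normr1 _) ey pr (v := u).
apply: (@cvg_unique _ (@norm_hausdorff _ K) _ _ _ _ h).
rewrite (_ : (fun m => _) = fun=> y (r u)); first exact: cvg_cst.
apply/funext => m; rewrite iter_transfer_comp // (iter_transfer_eigen _ _ _ _ _ ey) //.
rewrite (_ : ((lambda ^+ m *: y) \o r) u = lambda ^+ m *: y (r u)) //.
rewrite mulr1 scalerA mulVf ?scale1r // expf_neq0 // -normr_eq0 l1; exact: oner_neq0.
Qed.

(** Pairing with [r' w] cancels the left factor: for an eigenvector [y], [<P^m(r y) u, r' w> = a
    <P^m(y) u, w> = a lambda^m <y u, w>]. *)
Lemma dotp_commuting_circ x r r' a u w : peripheral_boundary P x ->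
  bounded_op r -> (forall i v, Theta i -> r (l i v) = l i (r v)) ->
  (forall i v, Theta i -> r' (l i v) = l i (r' v)) ->
  (forall u v, dotp (r u) (r' v) = a * dotp u v) ->
  dotp (circ r x u) (r' w) = a * dotp (x u) w.
Proof.
move=> px br rl rl' rr'; have pr := commuting_poisson br rl.
have ppr := poisson_peripheral pr.
apply: (peripheral_dotp_eq (P := P) (Phi := circ r)) px.
- by move=> y py; exact: circ_closed hcirc _ _ ppr py.
- by move=> c y z py pz; exact: (circ_linearr hcirc).
- exact: circ_continuousr.
move=> lambda y l1 ey; have by_ : bounded_op y by case: ey.
have h := circ_eigenspace hcirc (normr1 _) l1 pr ey (v := u).
have h' := cvg_comp _ _ h (@dotpl_continuous _ _ (r' w) _).
apply: (@cvg_unique _ (@norm_hausdorff _ R[i]^o) _ _ _ _ h').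
rewrite (_ : _ \o _ = fun=> a * dotp (y u) w); first exact: cvg_cst.
apply/funext => m /=; rewrite dotpZl mul1r.
have -> : dotp (iter m P (r \o y) u) (r' w) = a * dotp (iter m P y u) w.
  apply: (iter_transfer_dotp omega_ge0 omega_sum l_bounded l_isometry l_adjoint m
    (r := id)) => //; first exact: bounded_op_comp.
  by move=> u' w'; exact: rr'.
rewrite (iter_transfer_eigen _ _ _ _ _ ey) //.
rewrite (_ : (lambda ^+ m *: y) u = lambda ^+ m *: y u) // dotpZl mulrCA mulKf //.
by rewrite expf_neq0 // -normr_eq0 l1; exact: oner_neq0.
Qed.

End PeripheralTransfer.

(** * Operators commuting with the Poisson boundary *)

Section Triviality.
Context {R : realType} {H : hilbert R} {F : full_fock H}.
Variables (Theta : set nat) (e : nat -> H) (l l_adj : nat -> F -> F).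
Hypothesis he : orthonormal_basis Theta e.
Hypothesis hl : forall i, Theta i -> left_creation (e i) (l i).
Hypothesis hl_adj : forall i, Theta i -> is_adjoint (l i) (l_adj i).
Variable omega : nat -> R.
Hypothesis omega_ge0 : forall i, Theta i -> 0 <= omega i.
Hypothesis omega_sum :
  (fun n => \sum_(0 <= i < n | i \in Theta) omega i) @ \oo --> (1 : R).

Local Notation P := (weighted_transfer Theta omega l l_adj).
Local Notation right_creation := (@right_creation R H F Theta e).
Local Notation word := (@word R H F e).
Implicit Types x y : F -> F.

Let l_bounded i : Theta i -> bounded_op (l i).
Proof. by move=> Ti; exact: (left_creation_bounded hl). Qed.

Let l_isometry i u v : Theta i -> dotp (l i u) (l i v) = dotp u v.
Proof. exact: (left_creation_isometry he hl). Qed.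

(* The analogue, for the right shifts, of the relation [S^* T S = T] that
   characterizes Toeplitz operators. *)
Definition right_toeplitz y := forall j k r r', Theta j -> Theta k ->
  right_creation j r -> right_creation k r' ->
  forall u v, dotp (y (r u)) (r' v) = (j == k)%:R * dotp (y u) v.

Lemma iter_transfer_right_toeplitz m y : bounded_op y -> right_toeplitz y ->
  right_toeplitz (iter m P y).
Proof.
move=> by_ ty j k r r' Tj Tk rj rk.
apply: iter_transfer_dotp => // [i v Ti|i v Ti|u w].
- exact: (right_creation_comm he hl v Tj Ti rj).
- exact: (right_creation_comm he hl v Tk Ti rk).
- exact: ty.
Qed.

(** Here the rotation appears: [l_i] and [r_i] agree on the vacuum, and [l_i e_(V k) = r_k e_(i V)],
    so the Toeplitz relation leaves only the term [i = k], with [V k] turned into [k V]. *)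
Lemma dotp_transfer_vacuuml y V k : bounded_op y -> right_toeplitz y ->
  Theta k -> letters Theta V ->
  dotp (P y (word [::])) (word (rcons V k)) =
  (omega k)%:C * dotp (y (word [::])) (word (k :: V)).
Proof.
move=> by_ ty Tk lV; have [r rk] := right_creation_exists (F := F) he Tk.
have lE i : Theta i -> l i (word (rcons V k)) = r (word (i :: V)).
  by move=> Ti; rewrite (l_word hl) // rk.2 //= mem_set.
rewrite (dotp_transfer_single omega_ge0 omega_sum l_isometry hl_adj by_ Tk) //; last first.
  move=> i Ti ik; have [r' ri] := right_creation_exists (F := F) he Ti.
  rewrite lE // (l_word hl) // -[[:: i]]/(rcons [::] i) -ri.2 //.
  by rewrite (ty _ _ _ _ Ti Tk ri rk) (negbTE ik) mul0r.
rewrite lE // (l_word hl) // -[[:: k]]/(rcons [::] k) -rk.2 //.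
by rewrite (ty _ _ _ _ Tk Tk rk rk) eqxx mul1r.
Qed.

Lemma dotp_transfer_vacuumr y V k : bounded_op y -> right_toeplitz y ->
  Theta k -> letters Theta V ->
  dotp (P y (word (rcons V k))) (word [::]) =
  (omega k)%:C * dotp (y (word (k :: V))) (word [::]).
Proof.
move=> by_ ty Tk lV; have [r rk] := right_creation_exists (F := F) he Tk.
have lE i : Theta i -> l i (word (rcons V k)) = r (word (i :: V)).
  by move=> Ti; rewrite (l_word hl) // rk.2 //= mem_set.
rewrite (dotp_transfer_single omega_ge0 omega_sum l_isometry hl_adj by_ Tk) //; last first.
  move=> i Ti ik; have [r' ri] := right_creation_exists (F := F) he Ti.
  rewrite lE // (l_word hl) // -[[:: i]]/(rcons [::] i) -ri.2 //.
  by rewrite (ty _ _ _ _ Tk Ti rk ri) eq_sym (negbTE ik) mul0r.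
rewrite lE // (l_word hl) // -[[:: k]]/(rcons [::] k) -rk.2 //.
by rewrite (ty _ _ _ _ Tk Tk rk rk) eqxx mul1r.
Qed.

Lemma norm_word V : letters Theta V -> `|word V| = 1.
Proof.
move=> lV; apply/eqP; rewrite -(@eqrXn2 _ 2) // expr1n.
by rewrite dotp_norm (dotp_word he) // eqxx.
Qed.

Variable rho : R.
Hypothesis rho_ge0 : 0 <= rho.
Hypothesis rho_lt1 : rho < 1.
Hypothesis omega_le_rho : forall i, Theta i -> omega i <= rho.

(** The induction on [m] changes the word, so it must hold for all nonempty [V] at once; the common
    bound [rho] gives a rate independent of [V]. *)
Lemma right_toeplitz_decay (c : R) x m V :
  bounded_op x -> (forall u, `|x u| <= c%:C * `|u|) -> 0 <= c ->
  right_toeplitz x -> letters Theta V -> V != [::] ->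
  `|dotp (iter m P x (word [::])) (word V)| <= (rho ^+ m * c)%:C /\
  `|dotp (iter m P x (word V)) (word [::])| <= (rho ^+ m * c)%:C.
Proof.
move=> bx xc c0 tx; elim: m V => [|m IH] V lV V0.
  have h U W : letters Theta U -> letters Theta W -> `|dotp (x (word U)) (word W)| <= c%:C.
    move=> lU lW; rewrite (le_trans (dotp_le _ _)) // norm_word // mulr1.
    by rewrite (le_trans (xc _)) // norm_word // mulr1.
  by rewrite expr0 mul1r; split; apply: h.
case/lastP: V V0 lV => // V k _; rewrite letters_rcons => /andP[lV]; rewrite inE => Tk /=.
have by_ : bounded_op (iter m P x) by exact: iter_transfer_bounded.
have ty := iter_transfer_right_toeplitz m bx tx.
rewrite dotp_transfer_vacuuml // dotp_transfer_vacuumr // !normrM.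
have [h1 h2] : `|dotp (iter m P x (word [::])) (word (k :: V))| <= (rho ^+ m * c)%:C /\
    `|dotp (iter m P x (word (k :: V))) (word [::])| <= (rho ^+ m * c)%:C.
  by apply: IH => //=; rewrite mem_set.
have w0 : `|(omega k)%:C| = (omega k)%:C :> R[i].
  by rewrite ger0_norm // ler0c omega_ge0.
rewrite w0 exprS -mulrA rmorphM; split; apply: ler_pM => //;
  by rewrite ?ler0c ?omega_ge0 // lecR omega_le_rho.
Qed.

Lemma right_toeplitz_peripheral_scalar x :
  peripheral_boundary P x -> right_toeplitz x -> exists c, x = c *: (idfun : F -> F).
Proof.
move=> px tx; have bx := px.1.
have [c c0 xc] := bounded_op_ge0 bx.
have decay (d : R) : 0 < d -> exists N, forall m, (N <= m)%N -> rho ^+ m * c <= d.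
  move=> d0; have : rho ^+ m * c @[m --> \oo] --> 0 * c.
    by apply: cvgMl; apply: cvg_expr; rewrite ger0_norm.
  move=> /cvgrPdist_le/(_ d d0)[N _ hN]; exists N => m /hN /=.
  by rewrite mul0r sub0r normrN ger0_norm // mulr_ge0 // exprn_ge0.
have x0l V : letters Theta V -> V != [::] -> dotp (x (word [::])) (word V) = 0.
  move=> lV V0; apply: (peripheral_dotp_eq0 omega_ge0 omega_sum _ _ _ px) => // d d0.
  have [N hN] := decay d d0; exists N => m Nm.
  have [h _] := right_toeplitz_decay m bx xc c0 tx lV V0.
  by rewrite (le_trans h) // lecR hN.
have x0r V : letters Theta V -> V != [::] -> dotp (x (word V)) (word [::]) = 0.
  move=> lV V0; apply: (peripheral_dotp_eq0 omega_ge0 omega_sum _ _ _ px) => // d d0.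
  have [N hN] := decay d d0; exists N => m Nm.
  have [_ h] := right_toeplitz_decay m bx xc c0 tx lV V0.
  by rewrite (le_trans h) // lecR hN.
pose a := dotp (x (word [::])) (word [::]).
(* Common last letters are stripped from the two words by the Toeplitz relation until the letters
   differ or a word is empty. Then only the pair of empty words contributes, with the vacuum
   coefficient [a]. *)
have xE : forall u v, dotp (x u) v = a * dotp u v.
  apply: (dotp_word_ext he hl (S := idfun)) => [//||V W lV lW].
    exact: bounded_op_id.
  rewrite (dotp_word he) //; elim/last_ind: V W lV lW => [|V j IH] W.
    move=> _ lW; case: eqP => [<-|/eqP W0]; first by rewrite mulr1.
    by rewrite mulr0 x0l // eq_sym.
  move=> lVj; have : letters Theta (rcons V j) := lVj.
  rewrite letters_rcons => /andP[lV]; rewrite inE => Tj.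
  case/lastP: W => [_|W k lWk].
    by rewrite x0r // -?size_eq0 ?size_rcons //; case: (V) => [|? ?]; rewrite mulr0.
  have : letters Theta (rcons W k) := lWk; rewrite letters_rcons => /andP[lW]; rewrite inE => Tk.
  have [r rj] := right_creation_exists (F := F) he Tj.
  have [r' rk] := right_creation_exists (F := F) he Tk.
  rewrite -rj.2 // -rk.2 // (tx _ _ _ _ Tj Tk rj rk) IH // eqseq_rcons.
  by case: (j == k); rewrite ?andbT ?andbF ?mul1r // mul0r mulr0.
exists a; apply/funext => u; apply/eqP; rewrite -subr_eq0; apply/eqP/dotp_eq0.
by rewrite dotpBl xE -dotpZl subrr.
Qed.

End Triviality.

(** * The weights and the conclusion *)

Lemma real_weight_sum (R : realType) (Theta : set nat) (omega : nat -> R) :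
  (forall i, Theta i -> 0 <= omega i) ->
  (\sum_(i <oo | i \in Theta) (omega i)%:E = 1)%E ->
  (fun n => \sum_(0 <= i < n | i \in Theta) omega i) @ \oo --> (1 : R).
Proof.
move=> omega0 sum1.
have : (\sum_(0 <= i < n | i \in Theta) (omega i)%:E)%E @[n --> \oo] --> (1%:E : \bar R).
  rewrite -[X in _ --> X]sum1; apply: is_cvg_nneseries => n _; rewrite inE lee_fin.
  exact: omega0.
under eq_fun do rewrite sumEFin.
by move=> /fine_cvgP[].
Qed.

Lemma pair_weight_le1 (R : realType) (Theta : set nat) (omega : nat -> R) i j :
  (forall i, Theta i -> 0 <= omega i) ->
  (fun n => \sum_(0 <= i < n | i \in Theta) omega i) @ \oo --> (1 : R) ->
  Theta i -> Theta j -> i != j -> omega i + omega j <= 1.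
Proof.
move=> omega0 sum1 Ti Tj ij.
rewrite (le_trans _ (omega_sum_le1 omega0 sum1 (maxn i j).+1)) //.
rewrite big_mkcond (bigD1_seq i) ?mem_index_iota ?iota_uniq //=; last first.
  by rewrite ltnS leq_maxl.
rewrite mem_set // lerD2l big_mkcond.
rewrite (bigD1_seq j) ?mem_index_iota ?iota_uniq //=; last by rewrite ltnS leq_maxr.
rewrite mem_set // eq_sym ij lerDl; apply: sumr_ge0 => k _.
by case: ifP => // _; case: ifPn => //; rewrite inE => /omega0.
Qed.

Unset Implicit Arguments.

Theorem theoremA (R : realType) (Theta : set nat)
  (hTheta : (exists2 n : nat, (1 < n)%N & Theta = `I_n) \/ Theta = setT)
  (H : hilbert R) (e : nat -> H) (he : orthonormal_basis Theta e)
  (F : full_fock H) (l l_adj : nat -> F -> F)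
  (hl : forall i, Theta i -> left_creation (e i) (l i))
  (hl_adj : forall i, Theta i -> is_adjoint (l i) (l_adj i))
  (omega : nat -> R) (omega_gt0 : forall i, Theta i -> 0 < omega i)
  (omega_sum : (\sum_(i <oo | i \in Theta) (omega i)%:E = 1)%E)
  (circ : (F -> F) -> (F -> F) -> (F -> F))
  (hcirc : modified_choi_effros (weighted_transfer Theta omega l l_adj) circ) :
  [set x | peripheral_boundary (weighted_transfer Theta omega l l_adj) x /\
           forall a, poisson_boundary (weighted_transfer Theta omega l l_adj) a ->
             circ x a = circ a x]
  = range (fun c : R[i] => c *: (idfun : F -> F)).
Proof.
have omega_ge0 i : Theta i -> 0 <= omega i by move=> /omega_gt0/ltW.
have sum1 := real_weight_sum omega_ge0 omega_sum.
have l_bounded i : Theta i -> bounded_op (l i) by exact: (left_creation_bounded hl).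
have l_isometry i u v : Theta i -> dotp (l i u) (l i v) = dotp u v.
  exact: (left_creation_isometry he hl).
have [T0 T1] : Theta 0%N /\ Theta 1%N.
  by case: hTheta => [[n n1 ->]|->] //; split=> //=; exact: ltn_trans n1.
(* A weight other than [omega 0] is at most [1 - omega 0], and [omega 0] is at most
   [1 - omega 1]. *)
pose rho := Num.max (1 - omega 0%N) (1 - omega 1%N).
have w01 : omega 0%N + omega 1%N <= 1 by exact: pair_weight_le1 omega_ge0 sum1 _ _ _.
have rho_ge0 : 0 <= rho.
  by rewrite le_max; apply/orP; left; have := omega_ge0 _ T1; lra.
have rho_lt1 : rho < 1.
  by rewrite gt_max !gtrDl !oppr_lt0 !omega_gt0.
have omega_le i : Theta i -> omega i <= rho.
  move=> Ti; rewrite le_max; apply/orP; have [->|i0] := eqVneq i 0%N.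
    by right; lra.
  left; have := pair_weight_le1 omega_ge0 sum1 Ti T0 i0; lra.
apply/seteqP; split=> [x [px xcomm]|_ [c _ <-]].
  have [|c ->] := right_toeplitz_peripheral_scalar he hl hl_adj omega_ge0 sum1
    rho_ge0 rho_lt1 omega_le px; last by exists c.
  move=> j k r r' Tj Tk rj rk u v.
  have rl i w : Theta i -> r (l i w) = l i (r w).
    by move=> Ti; exact: (right_creation_comm he hl w Tj Ti rj).
  have rl' i w : Theta i -> r' (l i w) = l i (r' w).
    by move=> Ti; exact: (right_creation_comm he hl w Tk Ti rk).
  (* The Toeplitz relation in three moves: [x r] is the product of [x] and [r], the factors are
     exchanged by hypothesis, and pairing with the range of [r'] removes [r]. *)
  rewrite -(dotp_circ_commuting omega_ge0 sum1 l_isometry hl_adj hcirc _ _ px rj.1 rl).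
  rewrite xcomm; last first.
    exact: (commuting_poisson sum1 l_isometry hl_adj rj.1 rl).
  apply: (dotp_commuting_circ omega_ge0 sum1 l_bounded l_isometry hl_adj hcirc
    _ _ px rj.1 rl rl') => u' v'.
  exact: (dotp_right_creation he hl).
have pid : poisson_boundary (weighted_transfer Theta omega l l_adj) (idfun : F -> F).
  by apply: commuting_poisson => //; exact: bounded_op_id.
have pc : poisson_boundary (weighted_transfer Theta omega l l_adj)
    (c *: (idfun : F -> F)).
  have bc : bounded_op (c *: (idfun : F -> F)).
    by rewrite -[c *: _]addr0; exact: (bounded_op_lin c bounded_op_id bounded_op_zero).
  apply: commuting_poisson => // i v Ti.
  exact: esym (bounded_opZ (l_bounded i Ti) c v).
split; first exact: poisson_peripheral.
move=> a pa; apply/funext => v.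
have one1 : `|1 : R[i]| = 1 by exact: normr1.
(* Both products are limits of one and the same sequence, as the linear [a] commutes with the scalar
   [c]. *)
have h1 := circ_eigenspace hcirc one1 one1 pc pa (v := v).
have h2 := circ_eigenspace hcirc one1 one1 pa pc (v := v).
apply: (@cvg_unique _ (@norm_hausdorff _ F) _ _ _ _ h1).
rewrite (_ : (c *: idfun) \o a = a \o (c *: (idfun : F -> F))) //.
apply/funext => w /=; have [ba _] := pa.
exact: esym (bounded_opZ ba c w).
Qed.
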